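(* The operators $x'$, $D'$ and $E'+\frac{n}{2}\mathbf{id}$ generate, under the graded commutator, a finite-dimensional Lie superalgebra in $\mathrm{End}(\mathcal{P})$. Besides the anticommutation relations $\{x',x'\}=-2\sum_{j=1}^n(x_j')^2$, $\{D',D'\}=-2\Delta'$, $\{x',D'\}=-2E'-n\,\mathbf{id}$, the remaining commutation relations are $$[x',(x')^2]=0,\qquad [x',-\Delta']=2D',\qquad \left[E'+\tfrac n2\mathbf{id},x'\right]=x',$$ $$[D',(x')^2]=-2x',\qquad [D',-\Delta']=0,\qquad \left[E'+\tfrac n2\mathbf{id},D'\right]=-D',$$ $$[(x')^2,-\Delta']=-4\left(E'+\tfrac n2\mathbf{id}\right),\qquad \left[E'+\tfrac n2\mathbf{id},-(x')^2\right]=-2(x')^2,\qquad \left[E'+\tfrac n2\mathbf{id},-\Delta'\right]=2\Delta'.$$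
   Context: Let $n\ge 1$ and let $\mathbb{R}[\underline{x}]$ be the ring of real polynomials in $\underline{x}=(x_1,\ldots,x_n)$. A linear operator on $\mathbb{R}[\underline{x}]$ is shift-invariant if it commutes with all translations $f(\underline{x})\mapsto f(\underline{x}+\underline{y})$. A multivariate delta operator is a tuple $(O_{x_1},\ldots,O_{x_n})$ of shift-invariant linear operators on $\mathbb{R}[\underline{x}]$ for which there is a constant $c\ne0$ with $O_{x_j}(x_k)=c\,\delta_{jk}$ for all $j,k$. Fix such a tuple, together with linear operators $x_1',\ldots,x_n'$ on $\mathbb{R}[\underline{x}]$ satisfying the Weyl--Heisenberg relations $[O_{x_j},O_{x_k}]=0=[x_j',x_k']$, $[O_{x_j},x_k']=\delta_{jk}\mathbf{id}$. Here $[a,b]=ab-ba$ and $\{a,b\}=ab+ba$. Let $C\ell_{0,n}$ be the real Clifford algebra generated by $\mathbf{e}_1,\ldots,\mathbf{e}_n$ with $\mathbf{e}_j\mathbf{e}_k+\mathbf{e}_k\mathbf{e}_j=-2\delta_{jk}$, and $\mathcal{P}=\mathbb{R}[\underline{x}]\otimes C\ell_{0,n}$. The operators $O_{x_j},x_j'$ act on the polynomial factor and $\mathbf{e}_j$ acts by left multiplication. $\mathrm{End}(\mathcal{P})$ is the algebra of linear operators on $\mathcal{P}$. Put $D'=\sum_j\mathbf{e}_jO_{x_j}$, $x'=\sum_j\mathbf{e}_jx_j'$, $E'=\sum_jx_j'O_{x_j}$ and $\Delta'=\sum_jO_{x_j}^2$. Grading: $x'$ and $D'$ are odd, $E'+\frac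 n2\mathbf{id}$, $(x')^2$ and $\Delta'$ are even; the graded commutator of two odd elements is their anticommutator $\{\cdot,\cdot\}$, and otherwise it is $[\cdot,\cdot]$. *)

(* Defs.v *)
From HB Require Import structures.
From mathcomp Require Import all_boot all_algebra.
From mathcomp Require Import boolp reals mpoly ring.

Set Implicit Arguments.
Unset Strict Implicit.
Unset Printing Implicit Defensive.

Import GRing.Theory.
Local Open Scope ring_scope.

Section Endomorphisms.
Variables (R : comNzRingType) (V : lmodType R).

Definition End : Type := {linear V -> V}.

HB.instance Definition _ := gen_eqMixin End.
HB.instance Definition _ := gen_choiceMixin End.

Implicit Types f g h : End.

Lemma End_ext f g : f =1 g -> f = g.
Proof.
case: f g => [f [[fA] [fB]]] [g [[gA] [gB]]] /= /funext efg.
rewrite -{}efg in gA gB *.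
by rewrite (Prop_irrelevance fA gA) (Prop_irrelevance fB gB).
Qed.

Definition End_zero : End := \0.
Definition End_opp f : End := \- f.
Definition End_add f g : End := f \+ g.
Definition End_one : End := idfun.
Definition End_mul f g : End := f \o g.
Definition End_scale (a : R) f : End := a \*: f.

Fact End_addA : associative End_add.
Proof. by move=> f g h; apply: End_ext => u; rewrite /= addrA. Qed.
Fact End_addC : commutative End_add.
Proof. by move=> f g; apply: End_ext => u; rewrite /= addrC. Qed.
Fact End_add0 : left_id End_zero End_add.
Proof. by move=> f; apply: End_ext => u; rewrite /= add0r. Qed.
Fact End_addN : left_inverse End_zero End_opp End_add.
Proof. by move=> f; apply: End_ext => u; rewrite /= addNr. Qed.

HB.instance Definition _ :=
  GRing.isZmodule.Build End End_addA End_addC End_add0 End_addN.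

Fact End_mulA : associative End_mul.
Proof. by move=> f g h; apply: End_ext. Qed.
Fact End_mul1 : left_id End_one End_mul.
Proof. by move=> f; apply: End_ext. Qed.
Fact End_1mul : right_id End_one End_mul.
Proof. by move=> f; apply: End_ext. Qed.
Fact End_mulDl : left_distributive End_mul +%R.
Proof. by move=> f g h; apply: End_ext. Qed.
Fact End_mulDr : right_distributive End_mul +%R.
Proof. by move=> f g h; apply: End_ext => u; rewrite /= linearD. Qed.

HB.instance Definition _ := GRing.Zmodule_isPzRing.Build End
  End_mulA End_mul1 End_1mul End_mulDl End_mulDr.

Fact End_scaleA a b f : End_scale a (End_scale b f) = End_scale (a * b) f.
Proof. by apply: End_ext => u; rewrite /= scalerA. Qed.
Fact End_scale1 : left_id 1 End_scale.
Proof. by move=> f; apply: End_ext => u; rewrite /= scale1r. Qed.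
Fact End_scaleDr : right_distributive End_scale +%R.
Proof. by move=> a f g; apply: End_ext => u; rewrite /= scalerDr. Qed.
Fact End_scaleDl f : {morph End_scale^~ f : a b / a + b}.
Proof. by move=> a b; apply: End_ext => u; rewrite /= scalerDl. Qed.

HB.instance Definition _ := GRing.Zmodule_isLmodule.Build R End
  End_scaleA End_scale1 End_scaleDr End_scaleDl.

Lemma End_zeroE u : (0 : End) u = 0. Proof. by []. Qed.
Lemma End_oppE f u : (- f) u = - f u. Proof. by []. Qed.
Lemma End_addE f g u : (f + g) u = f u + g u. Proof. by []. Qed.
Lemma End_oneE u : (1 : End) u = u. Proof. by []. Qed.
Lemma End_mulE f g u : (f * g) u = f (g u). Proof. by []. Qed.
Lemma End_scaleE a f u : (a *: f) u = a *: f u. Proof. by []. Qed.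

Lemma End_scaleAl a f g : a *: (f * g) = (a *: f) * g.
Proof. by apply: End_ext. Qed.
Lemma End_scaleAr a f g : a *: (f * g) = f * (a *: g).
Proof. by apply: End_ext => u; rewrite /= linearZ. Qed.

End Endomorphisms.

Definition commutator (A : pzRingType) (a b : A) : A := a * b - b * a.
Definition anticommutator (A : pzRingType) (a b : A) : A := a * b + b * a.

(* Parities are booleans ([true] is odd), so their sum in Z/2 is [addb] and
   their product is [andb]. *)
Definition graded_commutator (A : pzRingType) (p q : bool) (a b : A) : A :=
  if p && q then anticommutator a b else commutator a b.

(* A Z/2-graded subspace (L false) (+) (L true) of a vector space A, with a
   bracket that is given on homogeneous elements, as a function of their
   parities. *)
Record lie_superalgebra (R : pzRingType) (A : lmodType R)
    (L : bool -> A -> Prop) (br : bool -> bool -> A -> A -> A) : Prop := {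
  lsa_zero : forall p, L p 0;
  lsa_lin : forall p (k : R) a b, L p a -> L p b -> L p (k *: a + b);
  lsa_direct : forall a, L false a -> L true a -> a = 0;
  lsa_bracket : forall p q a b, L p a -> L q b -> L (p (+) q) (br p q a b);
  lsa_linl : forall p q (k : R) a a' b, L p a -> L p a' -> L q b ->
    br p q (k *: a + a') b = k *: br p q a b + br p q a' b;
  lsa_linr : forall p q (k : R) a b b', L p a -> L q b -> L q b' ->
    br p q a (k *: b + b') = k *: br p q a b + br p q a b';
  lsa_skew : forall p q a b, L p a -> L q b ->
    br p q a b = - ((-1) ^+ (p && q) *: br q p b a);
  lsa_jacobi : forall p q r a b c, L p a -> L q b -> L r c ->
    br p (q (+) r) a (br q r b c) =
      br (p (+) q) r (br p q a b) c
      + (-1) ^+ (p && q) *: br q (p (+) r) b (br p r a c)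
}.

Definition finite_dimensional (R : pzRingType) (A : lmodType R)
    (L : bool -> A -> Prop) : Prop :=
  exists s : seq A, forall p a, L p a ->
    exists c : 'I_(size s) -> R, a = \sum_i c i *: s`_i.

(* The smallest Z/2-graded subspace of End V containing the homogeneous
   elements G and closed under the graded commutator. *)
Inductive lie_generated (R : comNzRingType) (V : lmodType R)
    (G : bool -> End V -> Prop) : bool -> End V -> Prop :=
| lie_gen p a : G p a -> lie_generated G p a
| lie_zero p : lie_generated G p 0
| lie_lin p (k : R) a b :
    lie_generated G p a -> lie_generated G p b ->
    lie_generated G p (k *: a + b)
| lie_bracket p q a b :
    lie_generated G p a -> lie_generated G q b ->
    lie_generated G (p (+) q) (graded_commutator p q a b).

Section Clifford.
Variables (R : comNzRingType) (n : nat).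
Implicit Types A B C : {set 'I_n}.

Definition symdiff A B : {set 'I_n} :=
  [set i | (i \in A) (+) (i \in B)].

(* With e_A the increasing product of the e_i for i in A, reordering gives
   e_A * e_B = (-1)^N e_{symdiff A B}: every pair (a, b) in A x B with b < a
   costs a transposition, and every pair with a = b a factor e_a^2 = -1. *)
Definition cl_sign A B : R :=
  \prod_(a in A) \prod_(b in B | (b <= a)%N) (-1).

(* An element is the family of its coordinates in the basis (e_A). *)
Definition Cl : Type := {ffun {set 'I_n} -> R}.
HB.instance Definition _ := GRing.Lmodule.copy Cl {ffun {set 'I_n} -> R^o}.

(* {ffun {set 'I_n} -> V} stands for V (x) Cl, the function u being
   \sum_A u A (x) e_A; this is left multiplication by the second factor. *)
Definition cl_lmul (V : lmodType R) (a : Cl) (u : {ffun {set 'I_n} -> V}) :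
    {ffun {set 'I_n} -> V} :=
  [ffun C => \sum_A (cl_sign A (symdiff A C) * a A) *: u (symdiff A C)].

Definition cl_basis A : Cl := [ffun B => (B == A)%:R].
Definition cl_one : Cl := cl_basis set0.
Definition cl_mul (a b : Cl) : Cl := cl_lmul (V := R^o) a b.

Lemma symdiffC A B : symdiff A B = symdiff B A.
Proof. by apply/setP=> i; rewrite !inE addbC. Qed.
Lemma symdiffA A B C : symdiff A (symdiff B C) = symdiff (symdiff A B) C.
Proof. by apply/setP=> i; rewrite !inE addbA. Qed.
Lemma symdiffK A B : symdiff A (symdiff A B) = B.
Proof. by apply/setP=> i; rewrite !inE addKb. Qed.
Lemma symdiff0 A : symdiff set0 A = A.
Proof. by apply/setP=> i; rewrite !inE. Qed.
Lemma symdiffv A : symdiff A A = set0.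
Proof. by apply/setP=> i; rewrite !inE addbb. Qed.

Let sgn (a b : 'I_n) : R := if (b <= a)%N then -1 else 1.

Let cl_signE A B : cl_sign A B = \prod_(a in A) \prod_(b in B) sgn a b.
Proof. by apply: eq_bigr => a _; rewrite big_mkcondr. Qed.

Let prod_symdiff (F : 'I_n -> R) A B : (forall i, F i * F i = 1) ->
  \prod_(i in symdiff A B) F i = (\prod_(i in A) F i) * \prod_(i in B) F i.
Proof.
move=> F2; rewrite !(big_mkcond (fun i => i \in _)) -big_split /=.
apply: eq_bigr => i _; rewrite !inE.
by case: (i \in A); case: (i \in B); rewrite //= ?mulr1 ?mul1r.
Qed.

Let sgn2 a b : sgn a b * sgn a b = 1.
Proof. by rewrite /sgn; case: ifP => _; rewrite ?mulrNN mulr1. Qed.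

Lemma cl_sign_symdiffl A B C :
  cl_sign (symdiff A B) C = cl_sign A C * cl_sign B C.
Proof.
rewrite !cl_signE prod_symdiff // => i.
by rewrite -big_split big1 // => j _; rewrite /= sgn2.
Qed.

Lemma cl_sign_symdiffr A B C :
  cl_sign A (symdiff B C) = cl_sign A B * cl_sign A C.
Proof.
rewrite !cl_signE -big_split; apply: eq_bigr => i _.
by rewrite prod_symdiff // => j; rewrite sgn2.
Qed.

Lemma cl_sign0 A : cl_sign set0 A = 1.
Proof. by rewrite /cl_sign big_set0. Qed.
Lemma cl_signr0 A : cl_sign A set0 = 1.
Proof. by rewrite cl_signE big1 // => i _; rewrite big_set0. Qed.
Lemma cl_sign1 i j : cl_sign [set i] [set j] = sgn i j.
Proof. by rewrite cl_signE !big_set1. Qed.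

Fact cl_lmul_linear (V : lmodType R) (a : Cl) : linear (@cl_lmul V a).
Proof.
move=> k u v; apply/ffunP => C; rewrite !ffunE scaler_sumr -big_split.
by apply: eq_bigr => A _; rewrite !ffunE scalerDr !scalerA [k * _]mulrC.
Qed.
HB.instance Definition _ (V : lmodType R) (a : Cl) := GRing.isLinear.Build R
  {ffun {set 'I_n} -> V} {ffun {set 'I_n} -> V} *:%R (@cl_lmul V a)
  (cl_lmul_linear a).

Lemma cl_lmulDl (V : lmodType R) (a b : Cl) (u : {ffun {set 'I_n} -> V}) :
  cl_lmul (a + b) u = cl_lmul a u + cl_lmul b u.
Proof.
apply/ffunP => C; rewrite !ffunE -big_split; apply: eq_bigr => A _.
by rewrite ffunE mulrDr scalerDl.
Qed.

Lemma cl_lmulZl (V : lmodType R) (k : R) (a : Cl)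
    (u : {ffun {set 'I_n} -> V}) : cl_lmul (k *: a) u = k *: cl_lmul a u.
Proof.
apply/ffunP => C; rewrite !ffunE scaler_sumr; apply: eq_bigr => A _.
by rewrite ffunE /= scalerA mulrCA.
Qed.

Lemma cl_lmulA (V : lmodType R) (a b : Cl) (u : {ffun {set 'I_n} -> V}) :
  cl_lmul (cl_mul a b) u = cl_lmul a (cl_lmul b u).
Proof.
apply/ffunP => C; rewrite !ffunE.
under eq_bigr => D _ do rewrite ffunE mulr_sumr scaler_suml.
rewrite exchange_big; apply: eq_bigr => A _.
rewrite ffunE scaler_sumr (reindex_inj (can_inj (symdiffK A))).
apply: eq_bigr => B _; rewrite symdiffK scalerA.
have -> : symdiff (symdiff A B) C = symdiff B (symdiff A C).
  by rewrite symdiffA (symdiffC B).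
congr (_ *: _); rewrite /GRing.scale /= cl_sign_symdiffl !cl_sign_symdiffr.
have sAB2 : cl_sign A B * cl_sign A B = 1.
  by rewrite -cl_sign_symdiffr symdiffv cl_signr0.
set x := cl_sign A B in sAB2 *.
by rewrite -[RHS]mul1r -sAB2; ring.
Qed.

Lemma cl_lmul_basisE (V : lmodType R) A (u : {ffun {set 'I_n} -> V}) C :
  cl_lmul (cl_basis A) u C = cl_sign A (symdiff A C) *: u (symdiff A C).
Proof.
rewrite ffunE (bigD1 A) //= big1 ?addr0 ?ffunE ?eqxx ?mulr1 // => B nBA.
by rewrite ffunE (negPf nBA) mulr0 scale0r.
Qed.

Lemma cl_lmul1 (V : lmodType R) (u : {ffun {set 'I_n} -> V}) :
  cl_lmul cl_one u = u.
Proof.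
by apply/ffunP => C; rewrite cl_lmul_basisE symdiff0 cl_sign0 scale1r.
Qed.

Lemma cl_basisM A B :
  cl_mul (cl_basis A) (cl_basis B) = cl_sign A B *: cl_basis (symdiff A B).
Proof.
apply/ffunP => C; rewrite [LHS]cl_lmul_basisE !ffunE.
case: (symdiff A C =P B) => [<-|nB]; first by rewrite symdiffK eqxx.
case: eqP => [eC|_]; last by rewrite ![_ *: _]mulr0.
by case: nB; rewrite eC symdiffK.
Qed.

Fact cl_mulA : associative cl_mul.
Proof. by move=> a b c; rewrite /cl_mul -cl_lmulA. Qed.
Fact cl_mul1 : left_id cl_one cl_mul.
Proof. by move=> a; rewrite /cl_mul cl_lmul1. Qed.
Fact cl_1mul : right_id cl_one cl_mul.
Proof.
move=> a; apply/ffunP => C.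
rewrite ffunE (bigD1 C) //= big1 ?addr0 => [|B nBC].
  by rewrite symdiffv cl_signr0 ffunE eqxx mul1r [_ *: _]mulr1.
rewrite ffunE; case: eqP => [BC|_]; last by rewrite [_ *: _]mulr0.
by case/eqP: nBC; rewrite -[C](symdiffK B) BC symdiffC symdiff0.
Qed.
Fact cl_mulDl : left_distributive cl_mul +%R.
Proof. by move=> a b c; rewrite [LHS]cl_lmulDl. Qed.
Fact cl_mulDr : right_distributive cl_mul +%R.
Proof. by move=> a b c; rewrite [LHS]linearD. Qed.
Fact cl_one_neq0 : cl_one != 0.
Proof.
by apply/eqP => /ffunP/(_ set0)/eqP; rewrite !ffunE eqxx oner_eq0.
Qed.

HB.instance Definition _ := GRing.Zmodule_isNzRing.Build Cl
  cl_mulA cl_mul1 cl_1mul cl_mulDl cl_mulDr cl_one_neq0.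

Fact cl_scaleAl (k : R) (a b : Cl) : k *: (a * b) = (k *: a) * b.
Proof. by rewrite [RHS]cl_lmulZl. Qed.
HB.instance Definition _ := GRing.Lmodule_isLalgebra.Build R Cl cl_scaleAl.

Fact cl_scaleAr (k : R) (a b : Cl) : k *: (a * b) = a * (k *: b).
Proof. by rewrite [RHS]linearZ. Qed.
HB.instance Definition _ := GRing.Lalgebra_isAlgebra.Build R Cl cl_scaleAr.

Definition cl_gen (i : 'I_n) : Cl := cl_basis [set i].

Lemma cl_gen_relation j k :
  cl_gen j * cl_gen k + cl_gen k * cl_gen j = (- (2 *+ (j == k))) *: 1.
Proof.
rewrite ![_ * _]cl_basisM !cl_sign1 symdiffC /sgn -scalerDl.
case: eqVneq => [->|njk].
  by rewrite leqnn symdiffv -opprD -mulr2n mulr1n.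
rewrite oppr0 scale0r; case: ltngtP => [_|_|/val_inj ejk].
- by rewrite addNr scale0r.
- by rewrite subrr scale0r.
- by rewrite ejk eqxx in njk.
Qed.

End Clifford.

Arguments Cl R n : clear implicits.
Arguments cl_gen {R n} i.

Section Operators.
Variables (R : realType) (n : nat).
Local Notation Rx := {mpoly R[n]}.
Implicit Types (O X : 'I_n -> End Rx).

Definition translate (y : 'I_n -> R) (f : Rx) : Rx :=
  f \mPo [tuple 'X_i + (y i)%:MP | i < n].

Definition shift_invariant (T : End Rx) : Prop :=
  forall (y : 'I_n -> R) (f : Rx), T (translate y f) = translate y (T f).

Definition delta_operator O : Prop :=
  (forall j, shift_invariant (O j)) /\
  exists2 c : R, c != 0 & forall j k, O j 'X_k = (c *+ (j == k))%:MP.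

Definition weyl_heisenberg O X : Prop :=
  forall j k, [/\ commutator (O j) (O k) = 0,
                  commutator (X j) (X k) = 0
                & commutator (O j) (X k) = 1 *+ (j == k)].

Definition Pol : Type := {ffun {set 'I_n} -> Rx}.
HB.instance Definition _ := GRing.Lmodule.on Pol.

(* T (x) id *)
Definition poly_fun (T : End Rx) (u : Pol) : Pol := [ffun A => T (u A)].
Fact poly_fun_linear T : linear (poly_fun T).
Proof. by move=> k u v; apply/ffunP => A; rewrite !ffunE linearP. Qed.
HB.instance Definition _ T :=
  GRing.isLinear.Build R Pol Pol *:%R (poly_fun T) (poly_fun_linear T).
Definition poly_op (T : End Rx) : End Pol := poly_fun T.

(* id (x) (left multiplication by a) *)
Definition cl_op (a : Cl R n) : End Pol := cl_lmul a.

Definition dirac O : End Pol := \sum_j cl_op (cl_gen j) * poly_op (O j).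
Definition vector_variable X : End Pol :=
  \sum_j cl_op (cl_gen j) * poly_op (X j).
Definition euler O X : End Pol := \sum_j poly_op (X j) * poly_op (O j).
Definition laplace O : End Pol := \sum_j poly_op (O j) ^+ 2.

End Operators.

(* Main.v *)
From HB Require Import structures.
Require Import Defs.
From mathcomp Require Import all_boot all_algebra.
From mathcomp Require Import boolp reals mpoly.

Set Implicit Arguments.
Unset Strict Implicit.
Unset Printing Implicit Defensive.

Import GRing.Theory.
Local Open Scope ring_scope.

(** The theorem has a combinatorial part, a formal part and a parity argument.

    Combinatorial part. Both x' and D' have the form sum_j e_j S_j, where the
    Clifford generators commute with the operators on polynomials. When
    [T_k, S_j] = delta_{jk} c, the anticommutator of sum_j e_j S_j and
    sum_k e_k T_k splits into the terms {e_j, e_k} S_j T_k, which only survive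
    on the diagonal, and the terms e_j^2 c, one for each j
    ([anticommutator_clifford_sum]). The cases (X, X), (O, O) and (X, O) are
    the three anticommutation relations; in particular
    {x', D'} = -2 H' with H' = E' + n/2, and (D')^2 = -Delta'. The
    Weyl-Heisenberg relations say that E' measures degree, so [H', x'] = x'
    and [H', D'] = -D' ([weyl_euler_X], [weyl_euler_O]).

    Formal part. The relations {x, D} = -2H, [H, x] = x, [H, D] = -D determine
    the Lie superalgebra osp(1|2): in any associative ring the graded Leibniz
    rule [graded_leibniz] turns them into all other brackets between
    H, x^2, D^2 (even) and x, D (odd). These five elements therefore span a
    space closed under the bracket ([osp_basis_bracket]), so that the generated
    algebra is finite-dimensional.

    Parity. The graded commutator satisfies the Lie superalgebra identities in
    every associative ring ([graded_skew], [graded_jacobi]). What remains is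
    that the even and odd parts of the generated algebra meet only in 0. The
    grading involution of the Clifford algebra commutes with H' and
    anticommutes with x' and D', hence it commutes with every generated even
    element and anticommutes with every odd one ([lie_generated_parity]); an
    operator doing both vanishes. *)

(** * The graded commutator in an associative ring *)

Section GradedCommutator.
Variable A : pzRingType.
Implicit Types (p q r : bool) (a b c : A).

Lemma graded_commutatorE p q a b :
  graded_commutator p q a b = a * b - (-1) ^+ (p && q) * (b * a).
Proof.
rewrite /graded_commutator mulr_sign.
by case: (p && q); rewrite ?opprK.
Qed.

(** The map [graded_commutator p _ a] is a superderivation: the mixed terms
    b a c cancel. *)
Lemma graded_leibniz p q r a b c :
  graded_commutator p (q (+) r) a (b * c) =
    graded_commutator p q a b * c
    + (-1) ^+ (p && q) * (b * graded_commutator p r a c).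
Proof.
rewrite !graded_commutatorE andb_addr signr_addb mulrBl !mulrBr !mulrA.
rewrite subrKA; congr (_ - _ * _ * _).
by rewrite -!mulrA (commr_sign b).
Qed.

Lemma graded_skew p q a b :
  graded_commutator p q a b =
    - ((-1) ^+ (p && q) * graded_commutator q p b a).
Proof.
rewrite !graded_commutatorE [q && p]andbC !mulr_sign.
by case: (p && q); rewrite ?opprK ?opprB // addrC.
Qed.

Lemma graded_commutatorBr p q a b c :
  graded_commutator p q a (b - c) =
    graded_commutator p q a b - graded_commutator p q a c.
Proof.
rewrite !graded_commutatorE mulrBl !mulrBr !opprB addrACA [RHS]addrACA.
by rewrite [- _ - _]addrC.
Qed.

Lemma graded_commutator_signr p q (e : bool) a b :
  graded_commutator p q a ((-1) ^+ e * b) =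
    (-1) ^+ e * graded_commutator p q a b.
Proof.
by rewrite !graded_commutatorE !mulr_sign; case: e; case: (p && q);
  rewrite ?mulrN ?mulNr ?opprK ?opprD ?opprK.
Qed.

(** Expanding the inner bracket of b and c and applying [graded_leibniz] to
    both products leaves four terms, which regroup into the two brackets on
    the right. *)
Lemma graded_jacobi p q r a b c :
  graded_commutator p (q (+) r) a (graded_commutator q r b c) =
    graded_commutator (p (+) q) r (graded_commutator p q a b) c
    + (-1) ^+ (p && q) *
        graded_commutator q (p (+) r) b (graded_commutator p r a c).
Proof.
rewrite [graded_commutator q r b c in LHS]graded_commutatorE.
rewrite graded_commutatorBr graded_commutator_signr graded_leibniz.
rewrite addbC graded_leibniz.
rewrite (graded_commutatorE (p (+) q)) (graded_commutatorE q (p (+) r)).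
set u := graded_commutator p q a b; set v := graded_commutator p r a c.
rewrite !mulr_sign.
by case: p u v; case: q; case: r => u v;
  rewrite /= ?opprD ?opprK -?addrA; congr (_ + _); rewrite addrA addrC.
Qed.
End GradedCommutator.

(** * Commutators and anticommutators *)

Section Commutators.
Variable A : pzRingType.
Implicit Types a b c : A.

Lemma commutatorC a b : commutator a b = - commutator b a.
Proof. by rewrite /commutator opprB. Qed.

Lemma commutatorDl a b c :
  commutator (a + b) c = commutator a c + commutator b c.
Proof. by rewrite /commutator mulrDl mulrDr opprD addrACA. Qed.

Lemma commutatorNl a b : commutator (- a) b = - commutator a b.
Proof. by rewrite /commutator mulNr mulrN opprD. Qed.

Lemma commutatorNr a b : commutator a (- b) = - commutator a b.
Proof. by rewrite commutatorC commutatorNl -commutatorC. Qed.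

Lemma commutatorMnl a b k : commutator (a *+ k) b = commutator a b *+ k.
Proof. by rewrite /commutator mulrnAl mulrnAr mulrnBl. Qed.

Lemma anticommutatorC a b : anticommutator a b = anticommutator b a.
Proof. exact: addrC. Qed.

Lemma anticommutatorNr a b : anticommutator a (- b) = - anticommutator a b.
Proof. by rewrite /anticommutator mulNr mulrN opprD. Qed.

Lemma anticommutatorMnr a b k :
  anticommutator a (b *+ k) = anticommutator a b *+ k.
Proof. by rewrite /anticommutator mulrnAl mulrnAr mulrnDl. Qed.

Lemma anticommutatorxx a : anticommutator a a = a ^+ 2 *+ 2.
Proof. by rewrite expr2 mulr2n. Qed.

Lemma commutatorM a b c :
  commutator a (b * c) = commutator a b * c + b * commutator a c.
Proof. by have /= := graded_leibniz false false false a b c; rewrite mul1r. Qed.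

(** The Leibniz rule for three odd elements, where the sign -1 turns the sum
    into a commutator. *)
Lemma commutator_sqr_odd a b :
  commutator a (b ^+ 2) = commutator (anticommutator a b) b.
Proof.
by have /= := graded_leibniz true true true a b b; rewrite mulN1r.
Qed.

Lemma commutator_sqr_even a b :
  commutator a (b ^+ 2) = anticommutator b (commutator a b).
Proof. by rewrite [LHS]commutatorM addrC. Qed.

Lemma commutator_sqrxx a : commutator a (a ^+ 2) = 0.
Proof. by rewrite /commutator -exprS -exprSr subrr. Qed.

End Commutators.

(** * The relations of osp(1|2) *)

Section Osp.
Variables (A : pzRingType) (x D H : A).
Hypotheses (xD : anticommutator x D = - (H *+ 2))
  (Hx : commutator H x = x) (HD : commutator H D = - D).

Lemma osp_x_sqrD : commutator x (D ^+ 2) = D *+ 2.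
Proof.
by rewrite commutator_sqr_odd xD commutatorNl commutatorMnl HD mulNrn opprK.
Qed.

Lemma osp_D_sqrx : commutator D (x ^+ 2) = - (x *+ 2).
Proof.
by rewrite commutator_sqr_odd anticommutatorC xD commutatorNl commutatorMnl Hx.
Qed.

Lemma osp_sqrx_sqrD : commutator (x ^+ 2) (D ^+ 2) = - (H *+ 4).
Proof.
rewrite commutator_sqr_even [commutator _ D]commutatorC osp_D_sqrx opprK.
by rewrite anticommutatorMnr anticommutatorC xD mulNrn -mulrnA.
Qed.

Lemma osp_H_sqrx : commutator H (x ^+ 2) = x ^+ 2 *+ 2.
Proof. by rewrite commutator_sqr_even Hx anticommutatorxx. Qed.

Lemma osp_H_sqrD : commutator H (D ^+ 2) = - (D ^+ 2 *+ 2).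
Proof.
by rewrite commutator_sqr_even HD anticommutatorNr anticommutatorxx.
Qed.

End Osp.

(** * Linear spans *)

Section LinearSpan.
Variables (R : pzRingType) (A : lmodType R).
Implicit Types (s t : seq A) (a b : A).

Definition in_span s a :=
  exists c : 'I_(size s) -> R, a = \sum_i c i *: s`_i.

Lemma in_span_ind s (P : A -> Prop) :
    P 0 -> (forall (k : R) a b, P a -> P b -> P (k *: a + b)) ->
    {in s, forall a, P a} ->
  forall a, in_span s a -> P a.
Proof.
move=> P0 Plin Ps _ [c ->].
apply: (big_ind P) => // [a b Pa Pb|i _].
  by rewrite -[a]scale1r; apply: Plin.
by rewrite -[_ *: _]addr0; apply: Plin => //; apply: Ps; rewrite mem_nth.
Qed.

Lemma in_span0 s : in_span s 0.
Proof.
by exists (fun=> 0); rewrite big1 // => i _; rewrite scale0r.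
Qed.

Lemma in_span_lin s (k : R) a b :
  in_span s a -> in_span s b -> in_span s (k *: a + b).
Proof.
move=> [c ->] [d ->]; exists (fun i => k * c i + d i).
rewrite scaler_sumr -big_split; apply: eq_bigr => i _.
by rewrite /= scalerDl scalerA.
Qed.

Lemma in_span_mem s a : a \in s -> in_span s a.
Proof.
move=> sa; have ia : (index a s < size s)%N by rewrite index_mem.
exists (fun i => (i == Ordinal ia)%:R).
rewrite (bigD1 (Ordinal ia)) //= big1 ?addr0 => [|i /negPf->]; last first.
  by rewrite scale0r.
by rewrite eqxx scale1r nth_index.
Qed.

Lemma in_spanN s a : in_span s a -> in_span s (- a).
Proof.
by move=> sa; rewrite -scaleN1r -[_ *: _]addr0; apply: in_span_lin (in_span0 s).
Qed.

Lemma in_spanMn s a k : in_span s a -> in_span s (a *+ k).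
Proof.
move=> sa; rewrite -scaler_nat -[_ *: _]addr0.
exact: in_span_lin (in_span0 s).
Qed.

Lemma sub_in_span s t : {subset s <= t} -> forall a, in_span s a -> in_span t a.
Proof.
move=> st; apply: in_span_ind (in_span0 t) (@in_span_lin t) _ => a /st.
exact: in_span_mem.
Qed.

End LinearSpan.

(** * Generated Lie superalgebras of operators *)

Section GeneratedSuperalgebra.
Variables (R : comNzRingType) (V : lmodType R).
Implicit Types (p q r : bool) (a b c : End V) (k : R).
Implicit Types G : bool -> End V -> Prop.

Lemma graded_commutator_linl p q k a a' b :
  graded_commutator p q (k *: a + a') b =
    k *: graded_commutator p q a b + graded_commutator p q a' b.
Proof.
rewrite !graded_commutatorE !mulr_sign mulrDl mulrDr -End_scaleAl -End_scaleAr.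
by case: (p && q); rewrite scalerDr ?scalerN ?opprD addrACA.
Qed.

Lemma graded_commutator_linr p q k a b b' :
  graded_commutator p q a (k *: b + b') =
    k *: graded_commutator p q a b + graded_commutator p q a b'.
Proof.
rewrite !graded_commutatorE !mulr_sign mulrDl mulrDr -End_scaleAl -End_scaleAr.
by case: (p && q); rewrite scalerDr ?scalerN ?opprD addrACA.
Qed.

(** The relation eps a = (-1)^p a eps is multiplicative in a with additive
    parities, and both products in a bracket have the same parity. *)
Lemma lie_generated_parity G (eps : End V) :
    (forall p a, G p a -> eps * a = (-1) ^+ p * (a * eps)) ->
  forall p a, lie_generated G p a -> eps * a = (-1) ^+ p * (a * eps).
Proof.
move=> epsG p a; elim=> {p a} [//|p|p k a b _ IHa _ IHb|p q a b _ IHa _ IHb].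
- by rewrite mul0r !mulr0.
- rewrite mulrDr -End_scaleAr IHa IHb mulrDl mulrDr.
  by rewrite End_scaleAr End_scaleAl.
have epsM p' q' a' b' : eps * a' = (-1) ^+ p' * (a' * eps) ->
    eps * b' = (-1) ^+ q' * (b' * eps) ->
    eps * (a' * b') = (-1) ^+ (p' (+) q') * (a' * b' * eps).
  rewrite !mulr_sign mulrA; case: p'; case: q' => /= -> eb;
  by rewrite ?mulNr -[a' * eps * b']mulrA eb ?mulrN ?opprK mulrA.
have ab := epsM _ _ _ _ IHa IHb.
have := epsM _ _ _ _ IHb IHa; rewrite [q (+) p]addbC => ba.
rewrite graded_commutatorE [_ * (b * a)]mulr_sign.
by case: (p && q); rewrite ?opprK ?(mulrBl, mulrBr, mulrDl, mulrDr) ab ba.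
Qed.

(** The only condition that can fail for a generated graded subspace is that
    its two parts are independent; an involution eps that detects the parity
    of the generators, and the absence of 2-torsion, guarantee it. *)
Lemma lie_generated_superalgebra G (eps : End V) :
    (forall a, a *+ 2 = 0 -> a = 0) ->
    eps * eps = 1 ->
    (forall p a, G p a -> eps * a = (-1) ^+ p * (a * eps)) ->
  lie_superalgebra (lie_generated G) (@graded_commutator (End V)).
Proof.
have signE (e : bool) a : (-1) ^+ e * a = (-1) ^+ e *: a.
  by rewrite mulr_sign scaler_sign.
move=> char2 eps2 epsG; split.
- exact: lie_zero.
- exact: lie_lin.
(* Here eps a = a eps = - eps a, so eps a = 0, and eps is invertible. *)
- move=> a /(lie_generated_parity epsG) a0 /(lie_generated_parity epsG) a1.
  rewrite mul1r in a0; rewrite mulN1r -a0 in a1.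
  have /char2 ea0 : (eps * a) *+ 2 = 0 by rewrite mulr2n {1}a1 addNr.
  by rewrite -[a]mul1r -eps2 -mulrA ea0 mulr0.
- exact: lie_bracket.
- by move=> *; apply: graded_commutator_linl.
- by move=> *; apply: graded_commutator_linr.
- by move=> *; rewrite graded_skew signE.
- by move=> *; rewrite graded_jacobi signE.
Qed.

(** By bilinearity, closure under the bracket need only be tested on the
    spanning families. *)
Lemma lie_generated_in_span G (s : bool -> seq (End V)) :
    (forall p a, G p a -> in_span (s p) a) ->
    (forall p q, {in s p & s q, forall a b,
      in_span (s (p (+) q)) (graded_commutator p q a b)}) ->
  forall p a, lie_generated G p a -> in_span (s p) a.
Proof.
move=> sG sbr p a; elim=> {p a} [//|p|p k a b _ sa _ sb|p q a b _ sa _ sb].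
- exact: in_span0.
- exact: in_span_lin.
have gc0 p' q' a' b' : (a' = 0) \/ (b' = 0) ->
    in_span (s (p' (+) q')) (graded_commutator p' q' a' b').
  by move=> [->|->]; rewrite graded_commutatorE ?(mul0r, mulr0) subrr;
    apply: in_span0.
move: a sa; apply: in_span_ind; first by apply: gc0; left.
  by move=> k a a' ? ?; rewrite graded_commutator_linl; apply: in_span_lin.
move=> a sa; move: b sb; apply: in_span_ind; first by apply: gc0; right.
  by move=> k b b' ? ?; rewrite graded_commutator_linr; apply: in_span_lin.
by move=> b sb; apply: sbr.
Qed.

Lemma in_span_finite_dimensional (s : bool -> seq (End V))
    (L : bool -> End V -> Prop) :
  (forall p a, L p a -> in_span (s p) a) -> finite_dimensional L.
Proof.
move=> sL; exists (s false ++ s true) => p a /sL.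
by apply: sub_in_span => b sb; rewrite mem_cat; case: p sb => ->; rewrite ?orbT.
Qed.

End GeneratedSuperalgebra.

(** * The span of the osp(1|2) basis *)

Section OspSpan.
Variables (R : comNzRingType) (V : lmodType R) (x D H : End V).
Hypotheses (xD : anticommutator x D = - (H *+ 2))
  (Hx : commutator H x = x) (HD : commutator H D = - D).

Definition osp_basis (p : bool) : seq (End V) :=
  if p then [:: x; D] else [:: H; x ^+ 2; D ^+ 2].

Lemma osp_basis_bracket p q : {in osp_basis p & osp_basis q, forall a b,
  in_span (osp_basis (p (+) q)) (graded_commutator p q a b)}.
Proof.
have mem r i : (i < size (osp_basis r))%N ->
    in_span (osp_basis r) (osp_basis r)`_i.
  by move=> ?; apply/in_span_mem/mem_nth.
have Hs := mem false 0%N isT; have x2s := mem false 1%N isT.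
have D2s := mem false 2%N isT.
have xs := mem true 0%N isT; have Ds := mem true 1%N isT.
have commxx (a : End V) : commutator a a = 0 by rewrite /commutator subrr.
have even_odd : {in osp_basis false & osp_basis true, forall a b,
    in_span (osp_basis true) (commutator a b)}.
  move=> a b; rewrite !inE => /or3P[] /eqP-> /orP[] /eqP->.
  - by rewrite Hx.
  - by rewrite HD; apply: in_spanN.
  - by rewrite commutatorC commutator_sqrxx oppr0; apply: in_span0.
  - by rewrite commutatorC (osp_D_sqrx xD Hx) opprK; apply: in_spanMn.
  - by rewrite commutatorC (osp_x_sqrD xD HD); apply/in_spanN/in_spanMn.
  - by rewrite commutatorC commutator_sqrxx oppr0; apply: in_span0.
case: p; case: q => a b sa sb; rewrite /graded_commutator /=.
- move: sa sb; rewrite !inE => /orP[] /eqP-> /orP[] /eqP->.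
  + by rewrite anticommutatorxx; apply: in_spanMn.
  + by rewrite xD; apply/in_spanN/in_spanMn.
  + by rewrite anticommutatorC xD; apply/in_spanN/in_spanMn.
  + by rewrite anticommutatorxx; apply: in_spanMn.
- by rewrite commutatorC; apply/in_spanN/even_odd.
- exact: even_odd.
have x2D2 := osp_sqrx_sqrD xD Hx.
move: sa sb; rewrite !inE => /or3P[] /eqP-> /or3P[] /eqP->.
- by rewrite commxx; apply: in_span0.
- by rewrite (osp_H_sqrx Hx); apply: in_spanMn.
- by rewrite (osp_H_sqrD HD); apply/in_spanN/in_spanMn.
- by rewrite commutatorC (osp_H_sqrx Hx); apply/in_spanN/in_spanMn.
- by rewrite commxx; apply: in_span0.
- by rewrite x2D2; apply/in_spanN/in_spanMn.
- by rewrite commutatorC (osp_H_sqrD HD) opprK; apply: in_spanMn.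
- by rewrite commutatorC x2D2 opprK; apply: in_spanMn.
- by rewrite commxx; apply: in_span0.
Qed.

End OspSpan.

(** * Polynomial and Clifford factors of the operators *)

Section WeylHeisenberg.
Variables (R : realType) (n : nat).
Local Notation Rx := {mpoly R[n]}.
Implicit Types (O X S T : 'I_n -> End Rx) (P Q : End Rx).

Lemma sum_delta (I : finType) (A : nmodType) (j : I) (F : I -> A) :
  \sum_i F i *+ (i == j) = F j.
Proof.
rewrite (bigD1 j) //= eqxx big1 ?addr0 // => i /negPf->.
by rewrite mulr0n.
Qed.

(** By the Leibniz rule only [O j, X k] contributes, and it selects j = k. *)
Lemma weyl_euler_X O X k : weyl_heisenberg O X ->
  commutator (\sum_j X j * O j) (X k) = X k.
Proof.
move=> OX; rewrite /commutator mulr_suml mulr_sumr -sumrB.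
rewrite -[RHS](sum_delta k X); apply: eq_bigr => j _.
rewrite -[LHS]opprB -[- _]/(- commutator _ _) commutatorM.
have [_ _ OXjk] := OX j k; have [_ XX _] := OX k j.
by rewrite XX mul0r add0r commutatorC OXjk mulrN opprK mulrnAr mulr1.
Qed.

Lemma weyl_euler_O O X k : weyl_heisenberg O X ->
  commutator (\sum_j X j * O j) (O k) = - O k.
Proof.
move=> OX; rewrite /commutator mulr_suml mulr_sumr -sumrB.
rewrite -[in RHS](sum_delta k O) -sumrN; apply: eq_bigr => j _.
rewrite -[LHS]opprB -[- _]/(- commutator _ _) commutatorM.
have [OO _ OXkj] := OX k j.
by rewrite OO OXkj mulr0 addr0 mulrnAl mul1r eq_sym.
Qed.

Lemma poly_opM P Q : poly_op (P * Q) = poly_op P * poly_op Q.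
Proof. by apply: End_ext => u; apply/ffunP => C; rewrite !ffunE. Qed.

Lemma poly_opB P Q : poly_op (P - Q) = poly_op P - poly_op Q.
Proof. by apply: End_ext => u; apply/ffunP => C; rewrite !ffunE. Qed.

Lemma poly_op1 : poly_op (1 : End Rx) = 1.
Proof. by apply: End_ext => u; apply/ffunP => C; rewrite !ffunE. Qed.

HB.instance Definition _ :=
  GRing.isZmodMorphism.Build (End Rx) (End (Pol R n)) (@poly_op R n) poly_opB.

Lemma cl_opM (a b : Cl R n) : cl_op (a * b) = cl_op a * cl_op b.
Proof. by apply: End_ext => u; apply: cl_lmulA. Qed.

Lemma cl_opD (a b : Cl R n) : cl_op (a + b) = cl_op a + cl_op b.
Proof. by apply: End_ext => u; apply: cl_lmulDl. Qed.

Lemma cl_opZ1 (k : R) : cl_op (k *: 1 : Cl R n) = k *: (1 : End (Pol R n)).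
Proof.
by apply: End_ext => u; rewrite [LHS]cl_lmulZl [cl_lmul _ _]cl_lmul1.
Qed.

Lemma cl_op_poly_op (a : Cl R n) P : cl_op a * poly_op P = poly_op P * cl_op a.
Proof.
apply: End_ext => u; apply/ffunP => C; rewrite !ffunE linear_sum.
by apply: eq_bigr => A _; rewrite !ffunE linearZ.
Qed.

Lemma cl_gen_anticommutator j k :
  anticommutator (cl_op (cl_gen j : Cl R n)) (cl_op (cl_gen k)) =
    - (1 *+ 2 *+ (j == k)).
Proof.
rewrite /anticommutator -!cl_opM -cl_opD cl_gen_relation cl_opZ1.
by rewrite scaleNr -scalerMnl scaler_nat.
Qed.

Lemma cl_gen_sqr j : cl_op (cl_gen j : Cl R n) * cl_op (cl_gen j) = - 1.
Proof.
rewrite -cl_opM [_ * _]cl_basisM cl_sign1 leqnn symdiffv cl_opZ1.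
by rewrite scaleN1r.
Qed.

(** The common form of the Dirac operator and of the vector variable, to which
    both are convertible. *)
Definition clifford_sum S : End (Pol R n) :=
  \sum_j cl_op (cl_gen j) * poly_op (S j).

(** Reordering T_k S_j as S_j T_k + delta_{jk} c leaves the Clifford
    anticommutators {e_j, e_k} in front of S_j T_k, and e_j^2 = -1 in front of
    the n copies of c. *)
Lemma anticommutator_clifford_sum S T (c : End Rx) :
    (forall j k, commutator (T k) (S j) = c *+ (k == j)) ->
  anticommutator (clifford_sum S) (clifford_sum T) =
    - ((\sum_j poly_op (S j) * poly_op (T j)) *+ 2) - poly_op c *+ n.
Proof.
move=> TS; pose e j := cl_op (cl_gen j : Cl R n).
have mulT S' T' : clifford_sum S' * clifford_sum T' =
    \sum_j \sum_k e j * e k * poly_op (S' j * T' k).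
  rewrite mulr_suml; apply: eq_bigr => j _; rewrite mulr_sumr.
  apply: eq_bigr => k _; rewrite poly_opM !mulrA; congr (_ * _).
  by rewrite -!mulrA cl_op_poly_op.
have term j k :
    e j * e k * poly_op (S j * T k) + e k * e j * poly_op (T k * S j) =
    (- (poly_op (S j) * poly_op (T j)) *+ 2 - poly_op c) *+ (k == j).
  have -> : T k * S j = S j * T k + c *+ (k == j) by rewrite -TS addrC subrK.
  rewrite raddfD mulrDr addrA -mulrDl.
  rewrite [e j * e k + _](cl_gen_anticommutator j k) [j == k]eq_sym.
  case: eqVneq => [->|_]; last by rewrite oppr0 mul0r raddf0 mulr0 addr0.
  rewrite !mulr1n [e j * e j]cl_gen_sqr mulN1r mulNr mulr_natl mulNrn.
  by rewrite poly_opM.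
rewrite /anticommutator !mulT [in X in _ + X]exchange_big -big_split /=.
under eq_bigr => j _.
  rewrite -big_split /=; under eq_bigr => k _ do rewrite term.
  rewrite sum_delta; over.
rewrite big_split /= sumrMnl sumrN sumr_const card_ord.
by rewrite !mulNrn.
Qed.

Lemma commutator_clifford_sum P S :
  commutator (poly_op P) (clifford_sum S) =
    clifford_sum (fun k => commutator P (S k)).
Proof.
rewrite /commutator mulr_sumr mulr_suml -sumrB; apply: eq_bigr => k _.
by rewrite poly_opB mulrBr !poly_opM !mulrA -cl_op_poly_op.
Qed.

(** The grading involution of the Clifford algebra, acting on the second
    factor: it multiplies the coefficient of e_A by (-1)^#|A|. *)
Definition grading_fun (u : Pol R n) : Pol R n :=
  [ffun A : {set 'I_n} => (-1) ^+ #|A| *: u A].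

Fact grading_fun_linear : linear grading_fun.
Proof.
move=> k u v; apply/ffunP => A; rewrite !ffunE scalerDr !scalerA.
by rewrite [k * _]mulrC.
Qed.
HB.instance Definition _ :=
  GRing.isLinear.Build R (Pol R n) (Pol R n) *:%R grading_fun
    grading_fun_linear.
Definition grading_op : End (Pol R n) := grading_fun.

Lemma grading_opK : grading_op * grading_op = 1.
Proof.
apply: End_ext => u; apply/ffunP => A; rewrite !ffunE scalerA.
by rewrite -expr2 sqrr_sign scale1r.
Qed.

Lemma grading_poly_op P : grading_op * poly_op P = poly_op P * grading_op.
Proof.
by apply: End_ext => u; apply/ffunP => A; rewrite !ffunE linearZ.
Qed.

Lemma odd_symdiff1 (j : 'I_n) (A : {set 'I_n}) :
  odd #|symdiff [set j] A| = ~~ odd #|A|.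
Proof.
case jA: (j \in A).
  have -> : symdiff [set j] A = A :\ j.
    by apply/setP => i; rewrite !inE; case: eqVneq => [->|_]; rewrite ?jA.
  by rewrite (cardsD1 j A) jA /= negbK.
have -> : symdiff [set j] A = j |: A.
  by apply/setP => i; rewrite !inE; case: eqVneq => [->|_]; rewrite ?jA.
by rewrite cardsU1 jA.
Qed.

(** The product e_j e_A is a multiple of e_B, where B is the symmetric
    difference of {j} and A, and #|B| has the other parity than #|A|. *)
Lemma grading_cl_gen j :
  grading_op * cl_op (cl_gen j) = - (cl_op (cl_gen j) * grading_op).
Proof.
apply: End_ext => u; apply/ffunP => A.
have genE v : cl_op (cl_gen j) v A =
    cl_sign R [set j] (symdiff [set j] A) *: v (symdiff [set j] A).
  exact: cl_lmul_basisE.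
have gradE v B : grading_op v B = (-1) ^+ odd #|B| *: v B.
  by rewrite ffunE signr_odd.
rewrite End_oppE !End_mulE gradE [RHS]ffunE !genE gradE.
by rewrite odd_symdiff1 signrN scaleNr scalerN opprK !scalerA mulrC.
Qed.

Lemma grading_clifford_sum S :
  grading_op * clifford_sum S = - (clifford_sum S * grading_op).
Proof.
rewrite mulr_sumr mulr_suml -sumrN; apply: eq_bigr => j _.
by rewrite mulrA grading_cl_gen mulNr -!mulrA grading_poly_op.
Qed.

End WeylHeisenberg.

(** * The theorem *)

Unset Implicit Arguments.

Theorem lemma2p3 (R : realType) (n : nat) (n_gt0 : (0 < n)%N)
    (O X : 'I_n -> End {mpoly R[n]})
    (O_delta : delta_operator O) (OX_wh : weyl_heisenberg O X) :
  let x' : End (Pol R n) := vector_variable X in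
  let D' : End (Pol R n) := dirac O in
  let E' : End (Pol R n) := euler O X in
  let Delta' : End (Pol R n) := laplace O in
  let Id : End (Pol R n) := 1 in
  let H' : End (Pol R n) := E' + (n%:R / 2) *: Id in
  let L : bool -> End (Pol R n) -> Prop :=
    lie_generated (fun p a => if p then a = x' \/ a = D' else a = H') in
  [/\ lie_superalgebra L (@graded_commutator (End (Pol R n))),
      finite_dimensional L
    & L false (x' ^+ 2) /\ L false Delta']
  /\
  [/\ anticommutator x' x' = - (2 *: \sum_j poly_op (X j) ^+ 2),
      anticommutator D' D' = - (2 *: Delta')
    & anticommutator x' D' = - (2 *: E') - n%:R *: Id]
  /\
  [/\ commutator x' (x' ^+ 2) = 0,
      commutator x' (- Delta') = 2 *: D'
    & commutator H' x' = x']
  /\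
  [/\ commutator D' (x' ^+ 2) = - (2 *: x'),
      commutator D' (- Delta') = 0
    & commutator H' D' = - D']
  /\
  [/\ commutator (x' ^+ 2) (- Delta') = - (4 *: H'),
      commutator H' (- x' ^+ 2) = - (2 *: x' ^+ 2)
    & commutator H' (- Delta') = 2 *: Delta'].
Proof.
move=> x' D' E' Delta' Id H' L.
(* The vanishing commutators are written with a Kronecker delta too: they are
   the case c = 0 of [anticommutator_clifford_sum]. *)
have OO j k : commutator (O k) (O j) = 0 *+ (k == j).
  by case: (OX_wh k j) => -> _ _; rewrite mul0rn.
have XX j k : commutator (X k) (X j) = 0 *+ (k == j).
  by case: (OX_wh k j) => _ -> _; rewrite mul0rn.
have OX j k : commutator (O k) (X j) = 1 *+ (k == j).
  by case: (OX_wh k j).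
have xx : anticommutator x' x' = - (2 *: \sum_j poly_op (X j) ^+ 2).
  rewrite (anticommutator_clifford_sum XX) raddf0 mul0rn subr0 scaler_nat.
  by congr (- (_ *+ 2)); apply: eq_bigr => j _; rewrite expr2.
have DD : anticommutator D' D' = - (2 *: Delta').
  rewrite (anticommutator_clifford_sum OO) raddf0 mul0rn subr0 scaler_nat.
  by congr (- (_ *+ 2)); apply: eq_bigr => j _; rewrite expr2.
have xD : anticommutator x' D' = - (2 *: E') - n%:R *: Id.
  by rewrite (anticommutator_clifford_sum OX) poly_op1 !scaler_nat.
have inj2 (a : End (Pol R n)) : a *+ 2 = 0 -> a = 0.
  move/(congr1 (fun b : End _ => (2^-1 : R) *: b)); rewrite scaler0 -scaler_nat.
  by rewrite scalerA mulVf ?scale1r // Num.Theory.pnatr_eq0.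
have D2 : D' ^+ 2 = - Delta'.
  apply/subr0_eq/inj2; rewrite mulrnBl -anticommutatorxx DD scaler_nat.
  by rewrite mulNrn subrr.
have xDH : anticommutator x' D' = - (H' *+ 2).
  rewrite xD mulrnDl opprD scaler_nat -scaler_nat; congr (_ - _).
  by rewrite -[in RHS]scaler_nat scalerA mulrC divfK // Num.Theory.pnatr_eq0.
have E'E : E' = poly_op (\sum_j X j * O j).
  by rewrite raddf_sum; apply: eq_bigr => j _; rewrite /= poly_opM.
(* The constant n/2 in H' is central. *)
have HE (a : End (Pol R n)) : commutator H' a = commutator E' a.
  rewrite /H' commutatorDl [X in _ + X]/commutator -End_scaleAl -End_scaleAr.
  by rewrite mul1r mulr1 subrr addr0.
have Hx : commutator H' x' = x'.
  rewrite HE E'E commutator_clifford_sum; apply: eq_bigr => k _.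
  by rewrite weyl_euler_X.
have HD : commutator H' D' = - D'.
  rewrite HE E'E commutator_clifford_sum -sumrN; apply: eq_bigr => k _.
  by rewrite weyl_euler_O // raddfN mulrN.
have Lx : L true x' by apply: lie_gen; left.
have LD : L true D' by apply: lie_gen; right.
(* The square of an odd a is half of the anticommutator of a with itself. *)
have Lsqr (a : End (Pol R n)) : L true a -> L false (a ^+ 2).
  move=> La; have := lie_bracket La La.
  rewrite /graded_commutator /= anticommutatorxx => La2.
  have := lie_lin (2^-1 : R) La2 (lie_zero _ _).
  by rewrite addr0 -scaler_nat scalerA mulVf ?scale1r // Num.Theory.pnatr_eq0.
have Lspan : forall p a, L p a -> in_span (osp_basis x' D' H' p) a.
  apply: lie_generated_in_span (osp_basis_bracket xDH Hx HD) => p a.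
  by case: p => [[]|] ->; apply: in_span_mem; rewrite !inE eqxx ?orbT.
have Lparity p a : (if p then a = x' \/ a = D' else a = H') ->
    grading_op R n * a = (-1) ^+ p * (a * grading_op R n).
  case: p => [[]|] ->; rewrite ?mulN1r ?mul1r; try exact: grading_clifford_sum.
  rewrite /H' mulrDl mulrDr E'E grading_poly_op -End_scaleAl -End_scaleAr.
  by rewrite mul1r mulr1.
have scale2 (a : End (Pol R n)) : 2 *: a = a *+ 2 by rewrite scaler_nat.
have scale4 (a : End (Pol R n)) : 4 *: a = a *+ 4 by rewrite scaler_nat.
split; [split | split; [split | split; [split | split; [split|split]]]] => //.
- exact: lie_generated_superalgebra inj2 (grading_opK R n) Lparity.
- exact: in_span_finite_dimensional Lspan.
- split; first exact: Lsqr.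
  have := lie_lin (-1 : R) (Lsqr _ LD) (lie_zero _ _).
  by rewrite D2 scaleN1r opprK addr0.
- exact: commutator_sqrxx.
- by rewrite -D2 (osp_x_sqrD xDH HD) scale2.
- by rewrite (osp_D_sqrx xDH Hx) scale2.
- by rewrite -D2 commutator_sqrxx.
- by rewrite -D2 (osp_sqrx_sqrD xDH Hx) scale4.
- by rewrite commutatorNr (osp_H_sqrx Hx) scale2.
- by rewrite -D2 (osp_H_sqrD HD) D2 scale2 mulNrn opprK.
Qed.
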